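(* Let $\Omega\subset\mathbb{R}^n$ be a bounded Lipschitz domain and let $\Phi\in\mathrm{Diff}_0(\overline{\Omega})$. Then there exists $v\in\mathcal{V}_0(\Omega)$ such that $\Phi=F[v]$.
   Context: $\Omega$ is connected. A Lipschitz domain has an outward unit normal $\mathbf{n}$ defined almost everywhere on $\partial\Omega$; conditions involving $\mathbf{n}$ are understood almost everywhere on $\partial\Omega$. $\mathrm{Diff}(\overline{\Omega})$ is the set of diffeomorphisms of $\overline{\Omega}$: a function $\Phi:\overline{\Omega}\to\mathbb{R}^n$ belongs to $\mathrm{Diff}(\overline{\Omega})$ if it is of class $C^1$ up to the boundary and is bijective (one-to-one and onto) in $\overline{\Omega}$. $\mathrm{Diff}_0(\overline{\Omega})$ is the subset of diffeomorphisms $\Phi$ that are isotopic to the identity: there exists a smooth field (isotopy) $X:\overline{\Omega}\times[0,1]\to\mathbb{R}^n$ such that (i) $X(\cdot,0)=\mathrm{id}$, the identity map; (ii) $X(\cdot,1)=\Phi$; (iii) $X(\cdot,t)\in\mathrm{Diff}(\overline{\Omega})$ for all $t\in[0,1]$; (iv) $\partial_tX(\cdot,t)\in C^1(\overline{\Omega})$ for all $t\in[0,1]$. $\mathcal{V}_0(\Omega)=\{v\in C^1(\overline{\Omega}\times[0,1];\mathbb{R}^n): v(\cdot,t)\cdot\mathbf{n}|_{\partial\Omega}=0\ \ \forall t\in[0,1]\}$. For $v\in\mathcal{V}_0(\Omega)$, the flow of $v$ is the map $X:\overline{\Omega}\times[0,1]\to\overline{\Omega}$ such that, for every $\xi\in\overline{\Omega}$,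 $\frac{\partial X}{\partial t}(\xi,t)=v(X(\xi,t),t)$ for $t\in(0,1]$ and $X(\xi,0)=\xi$; the time-one map is $F[v](\xi):=X(\xi,1)$.
   Formalization: Diff also requires a C^1 inverse up to the boundary (for Φ and every X(·,t)): with only ''C^1 and bijective'' the claim fails for Ω=(-1,1), Φ(x)=x^3, X=(1-t)x+tx^3. ''Smooth'' X is read as X and ∂_tX jointly C^1 up to the boundary. *)

(* Defs.v *)
From HB Require Import structures.
From mathcomp Require Import all_boot all_order all_algebra.
From mathcomp Require Import all_classical all_reals all_analysis.
Set Implicit Arguments.
Unset Strict Implicit.
Unset Printing Implicit Defensive.
Import Order.TTheory GRing.Theory Num.Theory.
Import numFieldNormedType.Exports.
Local Open Scope classical_set_scope.
Local Open Scope ring_scope.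

(* Points of R^n are row vectors 'rV[R]_n, which carry the sup norm; the
   Euclidean structure, needed for unit normals only, is [dot].  Maps defined
   on a closed set are total functions whose values elsewhere are ignored. *)

Section Regularity.
Context {R : realType} {V W : normedModType R}.

(* [Ck k U f]: f is of class C^k up to the boundary of the open set U, i.e.
   f is C^k in U and f and its derivatives of order <= k extend continuously
   to [closure U].  The function g below is the extension of 'D_h f. *)
Fixpoint Ck (k : nat) (U : set V) (f : V -> W) : Prop :=
  {within closure U, continuous f} /\
  (if k is k'.+1 then
     (forall x, U x -> differentiable f x) /\
     (forall h : V, exists g : V -> W,
        Ck k' U g /\ (forall x, U x -> g x = 'D_h f x))
   else True).

(* w is the derivative at t of the curve x : [0,1] -> W; it is one-sided when
   t is 0 or 1. *)
Definition deriv01 (x : R -> W) (t : R) (w : W) : Prop :=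
  (s - t)^-1 *: (x s - x t) @[s --> within `[0, 1] t^'] --> w.

End Regularity.

Section LipschitzDomains.
Context {R : realType} {n : nat}.
Local Notation E := 'rV[R]_n.+1.
Implicit Types (Omega : set E) (p x y z u w nu : E) (Q : 'M[R]_n.+1)
  (gam : 'rV[R]_n -> R).

Definition dot u w : R := \sum_i u ord0 i * w ord0 i.

Definition boundary Omega : set E := closure Omega `\` interior Omega.

(* The splitting R^(n+1) = R x R^n; the first coordinate is the vertical one. *)
Definition height z : R := z ord0 ord0.
Definition base z : 'rV[R]_n := @rsubmx R 1 1 n z.

(* Near p, in the orthonormal coordinates z = (y - p) *m Q, the set Omega is
   the part of a cylinder lying strictly below the graph of gam. *)
Definition lipschitz_chart Omega p Q gam : Prop :=
  [/\ Q *m Q^T = 1%:M,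
      exists k : R, k.-lipschitz gam,
      gam 0 = 0 &
      exists r h : R, [/\ 0 < r, 0 < h &
        forall y, let z := (y - p) *m Q in
          `|base z| < r -> `|height z| < h ->
          (Omega y <-> height z < gam (base z))]].

Definition bounded_lipschitz_domain Omega : Prop :=
  [/\ open Omega, connected Omega, Omega !=set0, bounded_set Omega &
      forall p, boundary Omega p -> exists Q gam, lipschitz_chart Omega p Q gam].

Definition gradient gam (a : 'rV[R]_n) : 'rV[R]_n :=
  \row_j 'D_(delta_mx ord0 j) gam a.

(* (1, - grad gam) / sqrt (1 + |grad gam|^2), rotated back by Q^T.  There is no
   such nu at the points of the boundary where gam is not differentiable. *)
Definition outward_normal Omega p nu : Prop :=
  exists Q gam, [/\ lipschitz_chart Omega p Q gam, differentiable gam (0 : 'rV[R]_n) &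
    let N : E := row_mx (1%:M : 'M[R]_1) (- gradient gam 0) in
    nu = (Num.sqrt (dot N N))^-1 *: (N *m Q^T)].

(* The d-dimensional (spherical) Hausdorff outer measure, without normalising
   constant and with sup-norm balls: for d = n it has the same null subsets of
   the boundary as the surface measure.  Covers are indexed by a subset I of
   nat, possibly empty, so that for d = 0 it is the counting measure. *)
Definition hausdorff_pre (d : nat) (delta : R) (A : set E) : \bar R :=
  ereal_inf [set e | exists (I : set nat) (c : nat -> E) (r : nat -> R),
    [/\ forall i, I i -> 0 < r i < delta,
        A `<=` \bigcup_(i in I) ball (c i) (r i) &
        e = \esum_(i in I) (r i ^+ d)%:E]].

Definition hausdorff (d : nat) (A : set E) : \bar R :=
  ereal_sup [set hausdorff_pre d delta A | delta in [set delta : R | 0 < delta]].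

Definition ae_boundary Omega (P : E -> Prop) : Prop :=
  hausdorff n [set x | boundary Omega x /\ ~ P x] = 0%E.

End LipschitzDomains.

Section Flows.
Context {R : realType} {n : nat}.
Local Notation E := 'rV[R]_n.+1.
Implicit Types (Omega : set E) (Phi : E -> E) (v X : E * R -> E).

(* The open set whose closure is (closure Omega) x [0,1]. *)
Definition cylinder Omega : set (E * R) := Omega `*` `]0, 1[.

(* The inverse of a diffeomorphism is C^1 as well: a C^1 bijection alone, such
   as x |-> x^3 on [-1, 1], is in general not the flow of a C^1 field. *)
Definition Diff Omega Phi : Prop :=
  [/\ Ck 1 Omega Phi,
      set_bij (closure Omega) (closure Omega) Phi &
      exists Psi : E -> E, Ck 1 Omega Psi /\
        (forall xi, closure Omega xi -> Psi (Phi xi) = xi)].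

(* Smoothness of an isotopy X, with dX its time derivative: both are C^1 in
   (xi, t) up to the boundary.  Every X of class C^2, a fortiori C^oo, up to
   the boundary qualifies, and so does the flow of a C^1 vector field. *)
Definition smooth_field Omega X dX : Prop :=
  [/\ Ck 1 (cylinder Omega) X,
      Ck 1 (cylinder Omega) dX &
      forall xi t, closure Omega xi -> 0 <= t <= 1 ->
        deriv01 (fun s => X (xi, s)) t (dX (xi, t))].

Definition isotopy_to Omega Phi X dX : Prop :=
  [/\ smooth_field Omega X dX,
      forall xi, closure Omega xi -> X (xi, 0) = xi,
      forall xi, closure Omega xi -> X (xi, 1) = Phi xi,
      forall t, 0 <= t <= 1 -> Diff Omega (fun xi => X (xi, t)) &
      forall t, 0 <= t <= 1 -> Ck 1 Omega (fun xi => dX (xi, t))].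

Definition Diff0 Omega Phi : Prop :=
  Diff Omega Phi /\ exists X dX, isotopy_to Omega Phi X dX.

Definition V0 Omega v : Prop :=
  Ck 1 (cylinder Omega) v /\
  forall t, 0 <= t <= 1 ->
    ae_boundary Omega (fun x =>
      forall nu, outward_normal Omega x nu -> dot (v (x, t)) nu = 0).

(* The equation is only imposed for t > 0, so the continuity of the trajectory
   at t = 0 has to be required for the initial condition to be meaningful. *)
Definition is_flow Omega v X : Prop :=
  forall xi, closure Omega xi ->
    [/\ forall t, 0 <= t <= 1 -> closure Omega (X (xi, t)),
        {within `[0, 1], continuous (fun t : R => X (xi, t))},
        X (xi, 0) = xi &
        forall t, 0 < t <= 1 ->
          deriv01 (fun s => X (xi, s)) t (v (X (xi, t), t))].

(* Phi = F[v] on (closure Omega). *)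
Definition is_time_one_map Omega v Phi : Prop :=
  exists X, is_flow Omega v X /\
    forall xi, closure Omega xi -> Phi xi = X (xi, 1).

End Flows.

(* Main.v *)
(* The field is v(x, t) = dX (X_t^-1 x, t), where dX is the time derivative of
   the isotopy X; each X(xi, .) solves X' = v(X, t).  The work is to show that v
   is C^1 up to the boundary.
   Let G be the continuous extension to (closure Omega) x [0, 1] of the spatial
   Jacobian of X.  On the dense set of the xi in Omega with X_t xi in Omega,
   the chain rule gives G(xi, t) H(X_t xi) = 1 with H the Jacobian of X_t^-1;
   by continuity G is invertible on the whole closed cylinder.  Hence X_t is
   locally onto, so it maps Omega into int (closure Omega) = Omega, and by
   symmetry it maps the boundary to the boundary.  The inverse of
   (xi, t) |-> (X(xi, t), t) is continuous by compactness, differentiable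
   inside, and its derivative is expressed through G^-1, which extends.
   Finally, trajectories starting on the boundary stay on it, i.e. on the graph
   gam of a chart, and differentiating height = gam(base) along them gives
   v . n = 0 at every point where gam is differentiable. *)

Require Import Defs.
From HB Require Import structures.
From mathcomp Require Import all_boot all_order all_algebra.
From mathcomp Require Import all_classical all_reals all_analysis.
From mathcomp Require Import ring lra.
Set Implicit Arguments.
Unset Strict Implicit.
Unset Printing Implicit Defensive.
Import Order.TTheory GRing.Theory Num.Theory.
Import numFieldNormedType.Exports.
Local Open Scope classical_set_scope.
Local Open Scope ring_scope.

(* Instance resolution fails on the neighbourhood filter of a matrix once
   unification has unfolded it. *)
#[local] Instance mx_nbhs_filter (R : realType) m k (y : 'M[R]_(m, k)) : Filter (nbhs y).
Proof. exact: nbhs_filter. Qed.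

(** * Limits of matrix-valued functions, entry by entry *)

Lemma cvg_mxP (R : realType) (T : Type) (F : set_system T) m k
    (f : T -> 'M[R]_(m, k)) (l : 'M[R]_(m, k)) {FF : Filter F} :
  (forall i j, f x i j @[x --> F] --> l i j) -> f @ F --> l.
Proof.
move=> fl; apply/cvgrPdist_lt => e e0.
have h i j : \forall x \near F, `|l i j - f x i j| < e.
  by move: (fl i j) => /cvgrPdist_lt; apply.
have hh : \forall x \near F, forall i j, `|l i j - f x i j| < e.
  by do 2! (apply: filter_forall => ?); exact: h.
apply: filterS hh => x hx.
rewrite [ltLHS]/Num.Def.normr/= mx_normrE (bigmax_lt) // => -[i j] _ /=.
by rewrite !mxE.
Qed.

Lemma cvg_mx_coord (R : realType) (T : Type) (F : set_system T) m k
    (f : T -> 'M[R]_(m, k)) (l : 'M[R]_(m, k)) i j {FF : Filter F} :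
  f @ F --> l -> f x i j @[x --> F] --> l i j.
Proof.
move=> fl; apply: (cvg_comp f (fun M : 'M[R]_(m, k) => M i j) fl).
exact: coord_continuous.
Qed.

Section MatrixLimits.
Context {R : realType} {T : Type} (F : set_system T) {FF : Filter F}.

Lemma cvg_sum_fin (I : Type) (r : seq I) (P : pred I) (f : I -> T -> R) (l : I -> R) :
  (forall i, P i -> f i @ F --> l i) ->
  (\sum_(i <- r | P i) f i x) @[x --> F] --> \sum_(i <- r | P i) l i.
Proof.
move=> fl; elim: r => [|i r IH].
  by under eq_fun do rewrite big_nil; rewrite big_nil; exact: cvg_cst.
under eq_fun do rewrite big_cons; rewrite big_cons; case: ifPn => // Pi.
exact: (cvgD (fl _ Pi) IH).
Qed.

Lemma cvg_prod_fin (I : Type) (r : seq I) (P : pred I) (f : I -> T -> R) (l : I -> R) :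
  (forall i, P i -> f i @ F --> l i) ->
  (\prod_(i <- r | P i) f i x) @[x --> F] --> \prod_(i <- r | P i) l i.
Proof.
move=> fl; elim: r => [|i r IH].
  by under eq_fun do rewrite big_nil; rewrite big_nil; exact: cvg_cst.
under eq_fun do rewrite big_cons; rewrite big_cons; case: ifPn => // Pi.
exact: (cvgM (fl _ Pi) IH).
Qed.

Lemma cvg_mulmx m k p (f : T -> 'M[R]_(m, k)) (g : T -> 'M[R]_(k, p))
    (a : 'M[R]_(m, k)) (b : 'M[R]_(k, p)) :
  f @ F --> a -> g @ F --> b -> (f x *m g x) @[x --> F] --> a *m b.
Proof.
move=> fa gb; apply: cvg_mxP => i j.
under eq_fun do rewrite mxE; rewrite mxE; apply: cvg_sum_fin => s _.
by apply: cvgM; apply: cvg_mx_coord.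
Qed.

Lemma cvg_det m (f : T -> 'M[R]_m) (a : 'M[R]_m) :
  f @ F --> a -> (\det (f x)) @[x --> F] --> \det a.
Proof.
move=> fa; apply: cvg_sum_fin => s _.
apply: cvgM; first exact: cvg_cst.
by apply: cvg_prod_fin => i _; exact: cvg_mx_coord.
Qed.

Lemma cvg_invmx m (f : T -> 'M[R]_m) (a : 'M[R]_m) : a \in unitmx ->
  f @ F --> a -> invmx (f x) @[x --> F] --> invmx a.
Proof.
move=> ua fa; have da := cvg_det fa.
have d0 : \det a != 0 by move: ua; rewrite unitmxE unitfE.
have -> : invmx a = (\det a)^-1 *: \adj a by rewrite /invmx ua.
have : ((\det (f x))^-1 *: \adj (f x)) @[x --> F] --> (\det a)^-1 *: \adj a.
  apply: cvgZ; first exact: (cvgV d0 da).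
  apply: cvg_mxP => i j.
  under eq_fun do rewrite mxE; rewrite mxE.
  apply: cvgM; first exact: cvg_cst.
  apply: cvg_det; apply: cvg_mxP => i' j'.
  by under eq_fun do rewrite !mxE; rewrite !mxE; exact: cvg_mx_coord.
apply: cvg_trans; apply: near_eq_cvg.
have : \forall x \near F, \det (f x) != 0.
  move: da => /cvgrPdist_lt /(_ `|\det a|); rewrite normr_gt0 => /(_ d0).
  apply: filterS => x; apply: contraPneq => ->.
  by rewrite subr0 ltxx.
by apply: filterS => x dx; rewrite /invmx unitmxE unitfE dx.
Qed.

End MatrixLimits.

(** * Differentials characterised by estimates, and the differential of an inverse *)

Section Differentials.
Context {R : realType} {V W : normedModType R}.

Lemma diff_eps (f : V -> W) x : differentiable f x ->
  forall e, 0 < e -> \forall h \near 0, `|f (h + x) - f x - 'd f x h| <= e * `|h|.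
Proof.
move=> /diff_locally /eqaddoP h e e0; apply: filterS (h e e0) => k.
by rewrite /= !fctE opprD addrA.
Qed.

Lemma diff_of_eps (f : V -> W) (df : V -> W) x : linear df -> continuous df ->
  (forall e, 0 < e -> \forall h \near 0, `|f (h + x) - f x - df h| <= e * `|h|) ->
  differentiable f x /\ 'd f x = df :> (V -> W).
Proof.
move=> ldf cdf h.
pose glM := GRing.isLinear.Build _ _ _ _ _ ldf.
pose gL : {linear _ -> _} := HB.pack df glM.
have H : f \o shift x = cst (f x) + df +o_ 0 id.
  apply/eqaddoP => e e0; apply: filterS (h e e0) => k.
  by rewrite /= !fctE opprD addrA.
have E : 'd f x = df :> (V -> W) by exact: (@diff_unique _ _ _ _ gL).
by split => //; apply/diff_locallyP; rewrite E.
Qed.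

Lemma diff_near_eq (f g : V -> W) x : f x = g x -> {near x, f =1 g} ->
  differentiable f x -> differentiable g x /\ 'd g x = 'd f x :> (V -> W).
Proof.
move=> fgx fg df; apply: diff_of_eps.
- exact: linearP.
- exact: diff_continuous.
move=> e e0; have := diff_eps df e0.
have : \forall h \near 0, f (h + x) = g (h + x).
  by move: fg; rewrite (near_shift 0); apply: filterS => h; rewrite /= subr0.
by apply: filterS2 => h -> ; rewrite fgx.
Qed.

End Differentials.

Section InverseDifferential.
Context {R : realType} {V W : normedModType R}.

(** With [u = B (w + A p) - p], differentiability gives [w = 'd A p u + o(u)]; applying [L] turns
    this into [L w - u = o(u)]. Continuity of [B] makes [u] small with [w], and [o(u)] is then shown
    to be [o(w)]. *)
Lemma inverse_diff (A : V -> W) (B : W -> V) (L : W -> V) p :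
  differentiable A p -> linear L -> continuous L ->
  (forall h, L ('d A p h) = h) ->
  {for A p, continuous B} -> B (A p) = p -> (\forall y \near A p, A (B y) = y) ->
  differentiable B (A p) /\ 'd B (A p) = L :> (W -> V).
Proof.
move=> dA lL cL LA cB BA AB; apply: diff_of_eps => // e e0.
pose glM := GRing.isLinear.Build _ _ _ _ _ lL.
pose gL : {linear _ -> _} := HB.pack L glM.
have [k k0 Lk] : exists2 k, k > 0 & forall x, `|L x| <= k * `|x|.
  exact: (@linear_lipschitz _ _ _ gL).
have LB a b : L (a - b) = L a - L b by exact: (raddfB gL).
(* The first bound gives [k * e1 <= 2^-1], so that the term in [u] is absorbed and [u] has norm at
   most [2 * k] times that of [w]. The second bound then brings the final error below [e]. *)
pose e1 := Num.min (2^-1 / k) (e / (2 * k * k)).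
have e10 : 0 < e1 by rewrite /e1 lt_min !divr_gt0// !mulr_gt0.
have hA := diff_eps dA e10.
have hA' : \forall w \near 0, 
    `|A (B (w + A p)) - A p - 'd A p (B (w + A p) - p)| <= e1 * `|B (w + A p) - p|.
  have cB' : (B (w + A p) - p) @[w --> 0] --> (0 : V).
    rewrite -(subrr p); apply: cvgB; last exact: cvg_cst.
    rewrite -[X in _ --> X]BA; apply: (@cvg_comp _ _ _ (fun x => x + A p) B _ (nbhs (A p))) cB.
    have : (x + A p) @[x --> (0 : W)] --> 0 + A p.
      by apply: cvgD; [exact: cvg_id|exact: cvg_cst].
    by rewrite add0r.
  have : \forall w \near 0, `|A (B (w + A p) - p + p) - A p - 'd A p (B (w + A p) - p)|
      <= e1 * `|B (w + A p) - p| by exact: cB' hA.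
  by apply: filterS => w; rewrite subrK.
have AB' : \forall w \near 0, A (B (w + A p)) = w + A p.
  by move: AB; rewrite (near_shift 0); apply: filterS => h; rewrite /= subr0.
apply: filterS2 hA' AB' => w hw hw'; move: hw; rewrite hw' addrK BA.
set u := B _ - p => hu.
have h1 : `|L w - u| <= k * (e1 * `|u|).
  rewrite -{1}(LA u) -LB; apply: le_trans (Lk _) _.
  by rewrite ler_wpM2l// ltW.
have ke : k * e1 <= 2^-1.
  by rewrite mulrC -ler_pdivlMr// /e1 ge_min lexx.
have hu2 : `|u| <= 2 * k * `|w|.
  have : `|u| <= k * `|w| + 2^-1 * `|u|.
    rewrite -{1}[u](subKr (L w)); apply: le_trans (ler_normB _ _) _.
    apply: lerD (Lk _) _; apply: le_trans h1 _.
    by rewrite mulrA ler_wpM2r.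
  by move=> ?; lra.
rewrite distrC; apply: le_trans h1 _.
rewrite mulrA; apply: (le_trans (ler_wpM2l _ hu2)).
  by rewrite mulr_ge0// ltW.
have : e1 <= e / (2 * k * k) by rewrite /e1 ge_min lexx orbT.
rewrite ler_pdivlMr ?mulr_gt0// => h3.
rewrite mulrA ler_wpM2r//; lra.
Qed.

End InverseDifferential.

(** * Continuity on closed sets and Lipschitz domains *)

Lemma within_nearP (S T : topologicalType) (A : set S) (f : S -> T) :
  {within A, continuous f} <->
  forall x, A x -> forall N, nbhs (f x) N -> \forall y \near x, A y -> N (f y).
Proof.
split=> [/subspace_continuousP cf x Ax N fN|cf]; first exact: cf _ Ax _ fN.
by apply/subspace_continuousP => x Ax N fN; exact: cf.
Qed.

Lemma within_comp (S T U : topologicalType) (A : set S) (B : set T)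
    (f : S -> T) (g : T -> U) :
  (forall x, A x -> B (f x)) -> {within A, continuous f} ->
  {within B, continuous g} -> {within A, continuous (g \o f)}.
Proof.
move=> AB /within_nearP cf /within_nearP cg.
apply/within_nearP => x Ax N gN.
have := cf _ Ax _ (cg _ (AB _ Ax) _ gN); apply: filterS => y h Ay.
by apply: h => //; exact: AB.
Qed.

Lemma continuous_open_within (S T : topologicalType) (A O : set S) (f : S -> T) x :
  open O -> O `<=` A -> O x -> {within A, continuous f} -> {for x, continuous f}.
Proof.
move=> oO OA Ox /within_nearP /(_ _ (OA _ Ox)) cf N fN.
have nO : nbhs x O by exact: open_nbhs_nbhs.
by apply: filterS2 (cf N fN) nO => y + /OA; apply.
Qed.

(** Makes one-sided filters at the ends of [[0, 1]] proper and the open interval dense in the closed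
    one. *)
Lemma itv01_approx (R : realType) (t e : R) : 0 <= t <= 1 -> 0 < e ->
  exists s, [/\ 0 < s < 1, s != t & `|t - s| < e].
Proof.
(* The step is taken towards the middle of the interval, and [4^-1] keeps it strictly inside. *)
move=> /andP[t0 t1] e0; pose d := Num.min (e / 2) 4^-1.
have d0 : 0 < d by rewrite lt_min divr_gt0 //= invr_gt0.
have de : d <= e / 2 by rewrite ge_min lexx.
have d2 : d <= 4^-1 by rewrite ge_min lexx orbT.
have [t2|t2] := leP t 2^-1.
  exists (t + d); split.
  - by apply/andP; split; lra.
  - by rewrite gt_eqF // ltrDl.
  - by rewrite opprD addNKr normrN gtr0_norm //; lra.
exists (t - d); split.
- by apply/andP; split; lra.
- by rewrite lt_eqF // ltrBlDr ltrDl.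
- by rewrite opprB addrC subrK gtr0_norm //; lra.
Qed.

Lemma closure_cylinder (R : realType) (V : normedModType R) (U : set V) :
  closure (U `*` [set` `]0, (1 : R)[] : set (V * R)%type) = closure U `*` [set` `[0, (1 : R)]].
Proof.
apply/seteqP; split=> [[x t] cp|[x t] [/= Ux t01]].
  split=> /=.
    move=> N Nx; have [|[y s] [[/= Uy _] Ny]] := cp (fst @^-1` N).
      exact: (@cvg_fst _ _ (nbhs x) (nbhs t) _ _ Nx).
    by exists y.
  have : closure [set` `]0, (1 : R)[] t.
    move=> N Nt; have [|[y s] [[/= _ s01] Ns]] := cp (snd @^-1` N).
      exact: (@cvg_snd _ _ (nbhs x) (nbhs t) _ _ Nt).
    by exists s.
  exact: itv_closure.
move=> N [[N1 N2] /= [N1x N2t] N12].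
have [y [Uy N1y]] := Ux _ N1x.
have [s [s01 N2s]] : ([set` `]0, (1 : R)[] `&` N2) !=set0.
  move: N2t => /nbhs_ballP[e /= e0 eN].
  move: t01; rewrite /= in_itv /= => t01.
  have [s [s01 _ ts]] := itv01_approx t01 e0.
  by exists s; split; [rewrite /= in_itv|exact: eN].
exists (y, s); split; first by split.
by apply: N12; split.
Qed.

Lemma lipschitz_continuous (R : realType) (V W : normedModType R) (k : R) (f : V -> W) :
  k.-lipschitz f -> continuous f.
Proof.
move=> lf x; apply/cvgrPdist_le => e e0.
have k0 : 0 < `|k| + 1 by rewrite ltr_wpDl.
near=> y; apply: (le_trans (lf (x, y) (conj I I))) => /=.
apply: (@le_trans _ _ ((`|k| + 1) * `|x - y|)).
  by rewrite ler_wpM2r // (le_trans (ler_norm k)) // lerDl.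
rewrite mulrC -ler_pdivlMr //; near: y.
by apply: cvgr_dist_le; [exact: cvg_id|rewrite divr_gt0].
Unshelve. all: by end_near. Qed.

(** * Domain and boundary seen in a Lipschitz chart *)

Section Charts.
Context {R : realType} {n : nat}.
Local Notation E := 'rV[R]_n.+1.

Lemma cvg_height T (F : set_system T) (f : T -> E) l {FF : Filter F} :
  f @ F --> l -> height (f x) @[x --> F] --> height l.
Proof. exact: cvg_mx_coord. Qed.

Lemma cvg_base T (F : set_system T) (f : T -> E) l {FF : Filter F} :
  f @ F --> l -> base (f x) @[x --> F] --> base l.
Proof.
move=> fl; apply: cvg_mxP => i j.
rewrite (_ : (fun x => _) = fun x => (f x) i (rshift 1 j)); last first.
  by apply/funext => x; rewrite mxE.
by rewrite mxE; exact: cvg_mx_coord.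
Qed.

Lemma continuous_chart (x y : E) (Q : 'M[R]_n.+1) :
  (fun z : E => (z - x) *m Q) @ y --> (y - x) *m Q.
Proof.
have h1 : (fun z : E => z - x) @ y --> y - x.
  by apply: cvgB; [exact: cvg_id|exact: cvg_cst].
exact: (cvg_mulmx h1 (cvg_cst Q)).
Qed.

(** A Lipschitz domain lies on one side of its boundary. A point of the left side outside [Omega]
    would be a boundary point, and the points just above it in a chart have neighbourhoods that miss
    [Omega]. *)
Lemma lipschitz_domain_regular (Omega : set E) : bounded_lipschitz_domain Omega ->
  (closure Omega)° `<=` Omega.
Proof.
move=> [oO _ _ _ charts] x xi; apply: contrapT => nOx.
have [Q [gam [QQ [k /lipschitz_continuous cg] g0 [r [h [r0 h0 ch]]]]]] : exists Q gam,
    lipschitz_chart Omega x Q gam.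
  by apply: charts; split; [exact: interior_subset|move=> /interior_subset].
pose Z (y : E) : E := (y - x) *m Q.
have cZ (y : E) : Z @ y --> Z y by exact: continuous_chart.
(* In chart coordinates [y e] is [(e, 0)], strictly above the graph for [e > 0] because
   [gam 0 = 0]. *)
pose d : E := delta_mx ord0 ord0.
pose y e : E := x + (e *: d) *m Q^T.
have Zy e : Z (y e) = e *: d.
  by rewrite /Z /y addrC addKr -mulmxA (mulmx1C QQ) mulmx1.
have hy e : height (Z (y e)) = e by rewrite Zy /height !mxE eqxx mulr1.
have by_ e : base (Z (y e)) = 0.
  by rewrite Zy; apply/rowP => j; rewrite !mxE /= ?andbF ?mulr0.
have cy : y e @[e --> 0^'+] --> x.
  have -> : nbhs x = nbhs (x + (0 *: d) *m Q^T) by rewrite scale0r mul0mx addr0.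
  apply: cvgD; first exact: cvg_cst.
  apply: (cvg_mulmx (f := fun e : R => e *: d) (g := fun=> Q^T)); last exact: cvg_cst.
  apply: cvgZ; last exact: cvg_cst.
  by apply: cvg_at_right_filter; exact: cvg_id.
have [e [e0 [eh cl]]] : exists e, 0 < e /\ e < h /\ (closure Omega) (y e).
  have ny : \forall e \near 0^'+, (closure Omega) (y e) by exact: (cy _ xi).
  near (0 : R)^'+ => e; exists e; split => //; split; near: e => //.
  exact: nbhs_right_lt.
have : \forall z \near y e, [/\ `|base (Z z)| < r, `|height (Z z)| < h &
    gam (base (Z z)) < height (Z z)].
  have cb : (fun z => base (Z z)) @ y e --> base (Z (y e)).
    by apply: cvg_base; exact: cZ.
  have chh : (fun z => height (Z z)) @ y e --> height (Z (y e)).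
    by apply: cvg_height; exact: cZ.
  have cgb : (fun z => gam (base (Z z))) @ y e --> gam (base (Z (y e))).
    exact: (cvg_comp (fun z => base (Z z)) gam cb (cg _)).
  have h1 : \forall z \near y e, `|base (Z z)| < r.
    apply: (cvgr_lt _ (cvg_norm cb)); by rewrite by_ normr0.
  have h2 : \forall z \near y e, `|height (Z z)| < h.
    by apply: (cvgr_lt _ (cvg_norm chh)); rewrite hy gtr0_norm.
  have h3 : \forall z \near y e, 0 < height (Z z) - gam (base (Z z)).
    apply: (cvgr_gt _ (cvgB chh cgb)); by rewrite hy by_ g0 subr0.
  by near=> z; split; [near: z..|rewrite -subr_gt0; near: z].
move=> /cl [z [Oz [b1 b2]]]; rewrite ltNge => /negP; apply; apply: ltW.
by apply/(ch z b1 b2).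
Unshelve. all: by end_near. Qed.

(** Both strict inequalities are excluded: points below the graph lie in the open set [Omega], and
    points above it have a neighbourhood above it, which misses [Omega]. *)
Lemma boundary_height (Omega : set E) p Q gam : open Omega -> lipschitz_chart Omega p Q gam ->
  exists r h, [/\ 0 < r, 0 < h & forall y : E, let z := (y - p) *m Q in
    `|base z| < r -> `|height z| < h -> boundary Omega y -> height z = gam (base z)].
Proof.
move=> oO [QQ [k /lipschitz_continuous cg] g0 [r [h [r0 h0 ch]]]].
exists r, h; split => // y z br hr [cy nOy].
apply/eqP; rewrite eq_le; apply/andP; split; last first.
  by rewrite leNgt; apply/negP => /(ch y br hr); move: nOy; rewrite ((interior_id _).1 oO).
rewrite leNgt; apply/negP => lt.
pose Z (y : E) : E := (y - p) *m Q.
have cZ : Z @ y --> Z y by exact: continuous_chart.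
have : \forall w \near y, [/\ `|base (Z w)| < r, `|height (Z w)| < h &
    gam (base (Z w)) < height (Z w)].
  have cb : (fun z => base (Z z)) @ y --> base (Z y).
    by apply: cvg_base; exact: cZ.
  have chh : (fun z => height (Z z)) @ y --> height (Z y).
    by apply: cvg_height; exact: cZ.
  have cgb : (fun z => gam (base (Z z))) @ y --> gam (base (Z y)).
    exact: (cvg_comp (fun z => base (Z z)) gam cb (cg _)).
  have h1 : \forall z \near y, `|base (Z z)| < r by exact: (cvgr_lt _ (cvg_norm cb)).
  have h2 : \forall z \near y, `|height (Z z)| < h by exact: (cvgr_lt _ (cvg_norm chh)).
  have h3 : \forall z \near y, 0 < height (Z z) - gam (base (Z z)).
    by apply: (cvgr_gt _ (cvgB chh cgb)); rewrite subr_gt0.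
  by near=> w; split; [near: w..|rewrite -subr_gt0; near: w].
move=> /cy [w [Ow [b1 b2]]]; rewrite ltNge => /negP; apply; apply: ltW.
by apply/(ch w b1 b2).
Unshelve. all: by end_near. Qed.

End Charts.

(** * Tangency along boundary trajectories *)

(** The empty cover has total weight 0. Tangency will hold at every boundary point that has a
    normal, so the exceptional set in [V0] will be empty. *)
Lemma hausdorff_set0 (R : realType) (n d : nat) :
  hausdorff d (set0 : set 'rV[R]_n.+1) = 0%E.
Proof.
have pre0 (delta : R) : hausdorff_pre d delta (set0 : set 'rV[R]_n.+1) = 0%E.
  apply/eqP; rewrite eq_le; apply/andP; split.
    apply: ereal_inf_lbound; exists set0, (fun=> 0), (fun=> 0).
    by split => //; rewrite esum_set0.
  apply: le_ereal_inf_tmp => _ [I [c [r [Ir _ ->]]]].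
  by apply: esum_ge0 => i /Ir /andP[ri _]; rewrite lee_fin exprn_ge0 // ltW.
rewrite /hausdorff (_ : [set _ | _ in _] = [set 0%E]) ?ereal_sup1 //.
apply/seteqP; split=> [_ [delta _ <-]|_ ->]; first exact: pre0.
by exists 1 => //=; exact: ltr01.
Qed.

Section Tangency.
Context {R : realType}.

(** Properness lets inequalities pass to the limit in one-sided derivatives, at 0 and 1 as well. *)
#[local] Instance proper_within01 (t : R) : 0 <= t <= 1 ->
  ProperFilter (within [set` `[0, 1]] t^').
Proof.
move=> t01; apply: Build_ProperFilter_ex => P.
move=> h; have {h}/nbhs_ballP[e /= e0 eP] :
    \forall s \near t, s != t -> [set` `[0, 1]] s -> P s by exact: h.
have [s [/andP[s0 s1] st ts]] := itv01_approx t01 e0.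
exists s; apply: eP => //; rewrite /= in_itv /=.
by rewrite !ltW.
Qed.

Lemma deriv01_cvg (V : normedModType R) (z : R -> V) t w :
  deriv01 z t w -> z s @[s --> within [set` `[0, 1]] t^'] --> z t.
Proof.
set F := within _ _ => dz.
have h1 : (s - t) @[s --> F] --> (0 : R).
  have h : (s - t) @[s --> t] --> (0 : R).
    by rewrite -[X in _ --> X](subrr t); apply: cvgB; [exact: cvg_id|exact: cvg_cst].
  apply: cvg_trans h; apply: cvg_app; apply: cvg_trans; first exact: cvg_within.
  exact: cvg_within.
have h2 : (z t + (s - t) *: ((s - t)^-1 *: (z s - z t))) @[s --> F] --> z t.
  rewrite -[X in _ --> X]addr0 -[X in _ + X](scale0r w).
  by apply: cvgD; [exact: cvg_cst|exact: cvgZ].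
apply: cvg_trans h2; apply: near_eq_cvg.
have : \forall s \near F, s != t.
  apply: (@cvg_within _ (dnbhs t)); rewrite /dnbhs /within /=.
  by apply: nearW => s.
apply: filterS => s st.
by rewrite scalerA mulfV ?subr_eq0 // scale1r addrC subrK.
Qed.

Context {n : nat}.
Local Notation E := 'rV[R]_n.+1.

Lemma dot_mulmx (u w : E) : dot u w = (u *m w^T) ord0 ord0.
Proof. by rewrite mxE; apply: eq_bigr => i _; rewrite mxE. Qed.

Lemma diff_gradient (gam : 'rV[R]_n -> R) a b : differentiable gam a ->
  'd gam a b = \sum_j b ord0 j * gradient gam a ord0 j.
Proof.
move=> dg; rewrite {1}[b]row_sum_delta linear_sum; apply: eq_bigr => j _.
by rewrite linearZ mxE deriveE.
Qed.

Lemma dot_graph_normal (u : E) (g : 'rV[R]_n) :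
  dot u (row_mx (1%:M : 'M[R]_1) (- g)) = height u - \sum_j base u ord0 j * g ord0 j.
Proof.
rewrite /dot big_ord_recl; congr (_ + _).
  by rewrite mxE; case: splitP => // j _; rewrite mxE !ord1 eqxx mulr1.
rewrite -sumrN; apply: eq_bigr => j _.
rewrite [X in _ * X]mxE; case: splitP => [k|k /= jk].
  by case: k => -[|k] kn // /eqP.
have -> : k = j by apply: val_inj; case: jk.
by rewrite !mxE mulrN; congr (- (u _ _ * _)); exact: val_inj.
Qed.

(** In the limit, the difference quotients of a curve on the graph satisfy [height = 'd gam 0 base],
    the equation of the tangent hyperplane, and this is orthogonality to the normal. *)
Lemma tangent_boundary (Omega : set E) nu (z : R -> E) t w :
  open Omega -> 0 <= t <= 1 -> outward_normal Omega (z t) nu ->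
  (forall s, 0 <= s <= 1 -> boundary Omega (z s)) -> deriv01 z t w ->
  dot w nu = 0.
Proof.
move=> oO t01 [Q [gam [ch dg ->]]] bz dz.
have [r [h [r0 h0 bh]]] := boundary_height oO ch.
have [QQ _ g0 _] := ch.
set N := row_mx _ _; set c := _^-1.
have -> : dot w (c *: (N *m Q^T)) = c * dot (w *m Q) N.
  by rewrite !dot_mulmx linearZ /= trmx_mul trmxK -scalemxAr mxE mulmxA.
rewrite dot_graph_normal -diff_gradient //.
set F := within [set` `[0, 1]] t^'.
have FF : ProperFilter F by exact: proper_within01.
pose q s : E := ((s - t)^-1 *: (z s - z t)) *m Q.
have cq : q @ F --> w *m Q by exact: (cvg_mulmx dz (cvg_cst Q)).
pose zeta s : E := (z s - z t) *m Q.
have cz : zeta @ F --> (0 : E).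
  have h1 : (z s - z t) @[s --> F] --> z t - z t.
    by apply: cvgB; [exact: deriv01_cvg dz|exact: cvg_cst].
  have : zeta @ F --> (z t - z t) *m Q by exact: (cvg_mulmx h1 (cvg_cst Q)).
  by rewrite subrr mul0mx.
have cb : (fun s => base (zeta s)) @ F --> (0 : 'rV[R]_n).
  have <- : base (0 : E) = 0 by apply/rowP => j; rewrite !mxE.
  exact: cvg_base.
have chh : (fun s => height (zeta s)) @ F --> (0 : R).
  have <- : height (0 : E) = 0 by rewrite /height mxE.
  exact: cvg_height.
have qE s : q s = (s - t)^-1 *: zeta s by rewrite /q -scalemxAl.
have graph : \forall s \near F, height (zeta s) = gam (base (zeta s)).
  have h1 : \forall s \near F, `|base (zeta s)| < r.
    by apply: (cvgr_lt _ (cvg_norm cb)); rewrite normr0.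
  have h2 : \forall s \near F, `|height (zeta s)| < h.
    by apply: (cvgr_lt _ (cvg_norm chh)); rewrite normr0.
  have h3 : \forall s \near F, 0 <= s <= 1.
    apply: withinT => //.
  near=> s; apply: bh; [near: s; exact: h1|near: s; exact: h2|].
  by apply: bz; near: s.
(* The first-order expansion of [gam] at 0, divided by [s - t], bounds the quotients [q s]; the
   bound passes to the limit for each [e]. *)
have key e : 0 < e ->
    `|height (w *m Q) - 'd gam 0 (base (w *m Q))| <= e * `|base (w *m Q)|.
  move=> e0.
  have cbq : (fun s => base (q s)) @ F --> base (w *m Q) by exact: cvg_base.
  have chq : (fun s => height (q s)) @ F --> height (w *m Q) by exact: cvg_height.
  have cdq : (fun s => 'd gam 0 (base (q s))) @ F --> 'd gam 0 (base (w *m Q)).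
    apply: (cvg_comp (fun s => base (q s)) ('d gam 0) cbq).
    exact: diff_continuous.
  apply: (ler_cvg_to (cvg_norm (cvgB chq cdq)) (cvgM (cvg_cst e) (cvg_norm cbq))).
  have small : \forall s \near F, `|gam (base (zeta s) + 0) - gam 0
      - 'd gam 0 (base (zeta s))| <= e * `|base (zeta s)|.
    exact: (cb _ (diff_eps dg e0)).
  apply: filterS2 graph small => s gs small; rewrite !fctE /=.
  have -> : height (q s) = (s - t)^-1 * height (zeta s) by rewrite qE /height mxE.
  have -> : base (q s) = (s - t)^-1 *: base (zeta s) by rewrite qE /base linearZ.
  move: small; rewrite gs g0 subr0 addr0 linearZ /= -mulrBr normrM normrZ mulrCA => small.
  by rewrite ler_wpM2l.
have -> : height (w *m Q) - 'd gam 0 (base (w *m Q)) = 0; last by rewrite mulr0.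
apply/eqP; rewrite -normr_le0; move: key.
set l := `|height _ - _|; set b := `|base _| => key.
rewrite leNgt; apply/negP => l0.
have b0 : 0 <= b by exact: normr_ge0.
have b1 : 0 < 2 * (b + 1) by rewrite mulr_gt0 // ltr_wpDl.
(* With [e = l / (2 * (b + 1))] the estimate would make [l] smaller than itself. *)
have := key _ (divr_gt0 l0 b1).
rewrite mulrAC ler_pdivlMr // leNgt => /negP; apply.
by nra.
Unshelve. all: by end_near. Qed.

End Tangency.

(** * Diffeomorphisms of the closure *)

(* A minimizer c of |f z - y| over a small closed ball is interior, and unless
   f c = y, moving c along -h with 'd f c h = f c - y would decrease the norm. *)
Lemma local_surj (R : realType) (V W : normedModType R) (f : V -> W) (U : set V) x :
  (forall r : R, compact [set y : V | `|x - y| <= r]) ->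
  open U -> U x -> (forall z, U z -> differentiable f z) ->
  (forall z, U z -> forall w, exists h, 'd f z h = w) ->
  (forall z1 z2, U z1 -> U z2 -> f z1 = f z2 -> z1 = z2) ->
  nbhs (f x) (f @` U).
Proof.
move=> cpt oU Ux df sf If.
have [r r0 rU] : exists2 r : R, 0 < r & [set y : V | `|x - y| <= r] `<=` U.
  have /nbhs_ballP[r /= r0 rU] : nbhs x U by exact: open_nbhs_nbhs.
  exists (r / 2); first exact: divr_gt0.
  move=> y /= yr; apply: rU; rewrite -ball_normE /=.
  by apply: le_lt_trans yr _; lra.
set C := [set y : V | _] in rU.
have cf : {in C, continuous f}.
  by move=> z; rewrite inE => /rU /df /differentiable_continuous.
have cdist (D : set V) (y : W) : D `<=` C -> {within D, continuous (fun z => `|f z - y|)}.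
  move=> DC; apply: continuous_in_subspaceT => z; rewrite inE => /DC Cz.
  apply: cvg_norm; apply: cvgB; last exact: cvg_cst.
  by apply: cf; rewrite inE.
(* [S] is the sphere of radius [r] about [x]. By injectivity [f] stays at distance at least [m] from
   [f x] on it, so for [y] within [m / 2] of [f x] the minimizer is not on [S]. *)
pose S := C `&` [set y : V | r <= `|x - y|].
have cS : compact S.
  apply: compact_closedI; first exact: cpt.
  apply: (@closed_comp _ _ (fun y : V => `|x - y|) [set s | r <= s]); last exact: closed_ge.
  move=> y _; apply: cvg_norm; apply: cvgB; [exact: cvg_cst|exact: cvg_id].
have [m m0 mS] : exists2 m : R, 0 < m & forall z, S z -> m <= `|f z - f x|.
  have [S0|S0] := pselect (S !=set0); last first.
    by exists 1 => // z Sz; case: S0; exists z.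
  have [//|c Sc cmin] := compact_EVT_min S0 cS (cdist S (f x) _); first by move=> ? [].
  move: Sc; rewrite inE => Sc.
  exists `|f c - f x|; last by move=> z Sz; apply: cmin; rewrite inE.
  rewrite normr_gt0 subr_eq0; apply/eqP => fcx.
  have cx : c = x by apply: If => //; apply: rU; case: Sc.
  by case: Sc => _ /=; rewrite cx subrr normr0 leNgt r0.
have Cx : C x by rewrite /C /= subrr normr0 ltW.
have C0 : C !=set0 by exists x.
apply/nbhs_ballP; exists (m / 2) => /=; first exact: divr_gt0.
move=> y; rewrite -ball_normE /= => ym.
have [//|c Cc cmin] := compact_EVT_min C0 (cpt r) (cdist C y _).
move: Cc; rewrite inE => Cc.
have cx := cmin x; rewrite inE in cx; have {}cx := cx Cx.
have ltcr : `|x - c| < r.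
  rewrite ltNge; apply/negP => rc.
  have := mS c (conj Cc rc); rewrite leNgt => /negP; apply.
  rewrite -(subrK y (f c)) -addrA; apply: (le_lt_trans (ler_normD _ _)).
  rewrite (distrC y) [m]splitr; apply: ltr_leD => //; last exact: ltW.
  exact: le_lt_trans cx _.
exists c; first exact: rU.
apply/eqP; rewrite -subr_eq0 -normr_le0 leNgt; apply/negP => w0.
have [h dh] := sf c (rU _ Cc) (f c - y).
have h1 : 0 < 2 * (`|h| + 1) by rewrite mulr_gt0 // ltr_wpDl.
(* For a step [- s *: h] the linear part shrinks [f c - y] by the factor [1 - s], and this [e] keeps
   the first-order error below the gain. *)
pose e := `|f c - y| / (2 * (`|h| + 1)).
have e0 : 0 < e by exact: divr_gt0.
have eh : e * `|h| < `|f c - y|.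
  rewrite /e mulrAC ltr_pdivrMr // ltr_pM2l //.
  by have := normr_ge0 h; lra.
have ck : (fun s : R => - s *: h) @ 0^'+ --> (0 : V).
  rewrite -[X in _ --> X](scale0r h) -[X in X *: _]oppr0.
  apply: cvgZ; last exact: cvg_cst.
  by apply: cvgN; apply: cvg_at_right_filter; exact: cvg_id.
have near1 : \forall s \near 0^'+, `|f (- s *: h + c) - f c - 'd f c (- s *: h)|
    <= e * `|- s *: h|.
  exact: (ck _ (diff_eps (df _ (rU _ Cc)) e0)).
have near2 : \forall s \near 0^'+, C (- s *: h + c).
  have cxs : (fun s : R => `|x - (- s *: h + c)|) @ 0^'+ --> `|x - c|.
    apply: cvg_norm; apply: cvgB; first exact: cvg_cst.
    rewrite -[X in _ --> X]add0r; apply: cvgD => //; exact: cvg_cst.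
  have : \forall s \near 0^'+, `|x - (- s *: h + c)| < r by exact: cvgr_lt cxs _ ltcr.
  by apply: filterS => s /ltW.
near (0 : R)^'+ => s.
have s0 : 0 < s by near: s; exact: nbhs_right_gt.
have s1 : s < 1 by near: s; exact: nbhs_right_lt.
have hs : `|f (- s *: h + c) - f c - 'd f c (- s *: h)| <= e * `|- s *: h|.
  by near: s; exact: near1.
have Cs : C (- s *: h + c) by near: s; exact: near2.
have := cmin (- s *: h + c); rewrite inE => /(_ Cs); rewrite leNgt => /negP; apply.
have E : 'd f c (- s *: h) = - (s *: (f c - y)) by rewrite linearZ /= dh scaleNr.
move: hs; rewrite E opprK normrZ normrN gtr0_norm //.
set w := f c - y => hs.
have -> : f (- s *: h + c) - y = f (- s *: h + c) - f c + s *: w + (1 - s) *: w.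
  by rewrite -addrA -scalerDl (addrC s) subrK scale1r /w addrA subrK.
apply: (le_lt_trans (ler_normD _ _)).
apply: (le_lt_trans (lerD hs (lexx _))).
rewrite normrZ gtr0_norm ?subr_gt0 //.
have : s * (e * `|h|) < s * `|w| by rewrite ltr_pM2l.
by rewrite mulrCA; lra.
Unshelve. all: by end_near. Qed.

(** * Continuous extension of Jacobians to the closure *)

Section UpToBoundary.
Context {R : realType}.

(** The rows of [G] are the extensions, provided by [Ck], of the derivatives along the [e i].
    Leaving these directions free serves both a space of row vectors and the space factor of a
    product with [R]. *)
Lemma Ck1_matrix (V : normedModType R) (U : set V) k m (e : 'I_m -> V)
    (Z : V -> 'rV[R]_k) : Ck 1 U Z ->
  exists G : V -> 'M[R]_(m, k), {within closure U, continuous G} /\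
    forall x, U x -> forall a : 'rV[R]_m,
      'd Z x (\sum_i a ord0 i *: e i) = a *m G x.
Proof.
move=> [_ [dZ eZ]].
have [g gP] := choice (fun i => eZ (e i)).
exists (fun x => \matrix_(i, j) g i x ord0 j); split.
  apply/subspace_continuousP => x Ux; apply: cvg_mxP => i j.
  rewrite mxE; under eq_fun do rewrite mxE.
  apply: cvg_mx_coord; have [[/subspace_continuousP cg _] _] := gP i; exact: cg.
move=> x Ux a; rewrite linear_sum; apply/rowP => j; rewrite summxE mxE.
apply: eq_bigr => i _; rewrite linearZ !mxE; congr (_ * _).
by have [_ ->] := gP i; rewrite ?deriveE //; exact: dZ.
Qed.

Lemma Ck1_jacobian m k (U : set 'rV[R]_m) (Z : 'rV[R]_m -> 'rV[R]_k) : Ck 1 U Z ->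
  exists G : 'rV[R]_m -> 'M[R]_(m, k), {within closure U, continuous G} /\
    forall x, U x -> forall a, 'd Z x a = a *m G x.
Proof.
move=> /(Ck1_matrix (fun i => delta_mx ord0 i)) [G [cG dG]]; exists G; split => //.
by move=> x Ux a; rewrite {1}[a]row_sum_delta dG.
Qed.

Lemma Ck1_jacobian_prod m k (U : set ('rV[R]_m * R)) (Z : 'rV[R]_m * R -> 'rV[R]_k) :
  Ck 1 U Z ->
  exists (G : 'rV[R]_m * R -> 'M[R]_(m, k)) (g : 'rV[R]_m * R -> 'rV[R]_k),
    [/\ {within closure U, continuous G}, {within closure U, continuous g} &
    forall x, U x -> forall a s, 'd Z x (a, s) = a *m G x + s *: g x].
Proof.
move=> CZ; have [_ [dZ eZ]] := CZ.
have [g [[cg _] gE]] := eZ (0, 1).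
have [G [cG dG]] := Ck1_matrix (fun i : 'I_m => (delta_mx ord0 i : 'rV[R]_m, 0 : R)) CZ.
exists G, g; split => // x Ux a s.
have -> : (a, s) = (\sum_i a ord0 i *: (delta_mx ord0 i : 'rV[R]_m, 0 : R)) + s *: (0, 1).
  have -> : \sum_i a ord0 i *: (delta_mx ord0 i : 'rV[R]_m, 0 : R) = (a, 0).
    rewrite {2}[a]row_sum_delta.
    elim/big_rec2 : _ => //= i y z _ ->.
    transitivity ((a ord0 i *: delta_mx ord0 i + y, a ord0 i * 0 + 0) : 'rV[R]_m * R) => //.
    by rewrite mulr0 addr0.
  transitivity ((a + s *: 0, 0 + s * 1) : 'rV[R]_m * R) => //.
  by rewrite scaler0 addr0 mulr1 add0r.
rewrite linearD linearZ /= dG // gE // deriveE //; exact: dZ.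
Qed.

(** The set where [f] and [g] differ is relatively open in [A], so it contains no limit point of
    [D]. Identities between derivatives reach the boundary in this way. *)
Lemma within_eq_dense (V : topologicalType) (W : normedModType R) (A D : set V)
    (f g : V -> W) x : A x -> D `<=` A -> closure D x ->
  {within A, continuous f} -> {within A, continuous g} ->
  (forall y, D y -> f y = g y) -> f x = g x.
Proof.
move=> Ax DA Dx /subspace_continuousP /(_ _ Ax) cf /subspace_continuousP /(_ _ Ax) cg fg.
apply/eqP; rewrite -subr_eq0 -normr_le0 leNgt; apply/negP => h.
have : \forall y \near within A (nbhs x), 0 < `|f y - g y|.
  by apply: cvgr_gt h; apply: cvg_norm; exact: cvgB cf cg.
rewrite /within /= => /Dx[y [Dy]] /(_ (DA _ Dy)).
by rewrite fg // subrr normr0 ltxx.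
Qed.

End UpToBoundary.

(** * Invertible Jacobians; interior and boundary are preserved *)

Section Diffeomorphisms.
Context {R : realType} {n : nat}.
Local Notation E := 'rV[R]_n.+1.
Implicit Types (Omega : set E) (Phi Psi : E -> E).

Lemma Diff_sym Omega Phi : Diff Omega Phi ->
  exists Psi, [/\ Diff Omega Psi,
    forall xi, closure Omega xi -> Psi (Phi xi) = xi &
    forall x, closure Omega x -> Phi (Psi x) = x].
Proof.
move=> [CPhi [Phi_fun Phi_inj Phi_surj] [Psi [CPsi PsiK]]].
have PhiK x : closure Omega x -> Phi (Psi x) = x.
  by move=> /Phi_surj[xi cxi <-]; rewrite PsiK.
exists Psi; split => //; split => //; last by exists Phi.
split.
- by move=> _ /Phi_surj[xi cxi <-]; rewrite PsiK.
- by move=> x y; rewrite !inE => cx cy /(congr1 Phi); rewrite !PhiK.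
- by move=> xi cxi; exists (Phi xi); [exact: Phi_fun|exact: PsiK].
Qed.

(* Omega is open and dense in its closure, and so is its preimage under the
   homeomorphism Phi of that closure: this replaces invariance of domain. *)
Lemma Diff_dense Omega Phi : open Omega -> Diff Omega Phi ->
  closure Omega `<=` closure [set xi | Omega xi /\ Omega (Phi xi)].
Proof.
move=> oO dPhi xi cxi N Nxi.
have [Psi [dPsi PsiK PhiK]] := Diff_sym dPhi.
have [CPhi [Phi_fun _ _] _] := dPhi.
have [[cPsi _] [Psi_fun _ _] _] := dPsi.
have [xi0 [ox0 nx0]] := cxi _ (nbhs_interior Nxi).
have O0c : closure Omega xi0 by exact: subset_closure.
have nbh : nbhs (Psi (Phi xi0)) (Omega `&` N°).
  rewrite PsiK //; apply: open_nbhs_nbhs; split => //.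
  by apply: openI => //; exact: open_interior.
move: cPsi => /within_nearP /(_ _ (Phi_fun _ O0c) _ nbh) h.
have [y [Oy /= hy]] := Phi_fun _ O0c _ h.
have yc : closure Omega y by exact: subset_closure.
have [ox1 nx1] := hy yc.
exists (Psi y); split; last exact: interior_subset.
by rewrite /= PhiK.
Qed.

(** As [Phi x] may still lie on the boundary, the chain rule is available only on the dense set [D].
    The identity [G x *m H (Phi x) = 1%:M] then extends to the closure by continuity. *)
Lemma Diff_unitmx Omega Phi (G : E -> 'M[R]_n.+1) : open Omega -> Diff Omega Phi ->
  {within closure Omega, continuous G} ->
  (forall x, Omega x -> forall a, 'd Phi x a = a *m G x) ->
  forall x, closure Omega x -> G x \in unitmx.
Proof.
move=> oO dPhi cG dG x cx.
have [Psi [dPsi PsiK PhiK]] := Diff_sym dPhi.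
have [[cPhi [difPhi _]] [Phi_fun _ _] _] := dPhi.
have [CPsi _ _] := dPsi; have [_ [difPsi _]] := CPsi.
have [H [cH dH]] := Ck1_jacobian CPsi.
suff : G x *m H (Phi x) = 1%:M by move=> /mulmx1_unit[].
pose D := [set xi | Omega xi /\ Omega (Phi xi)].
have DO : D `<=` closure Omega by move=> y [Oy _]; exact: subset_closure.
apply: (@within_eq_dense _ _ _ (closure Omega) D (fun x => G x *m H (Phi x))
    (fun=> 1%:M)) => //.
- exact: Diff_dense.
- have cHP := within_comp Phi_fun cPhi cH.
  apply/subspace_continuousP => y cy.
  by apply: cvg_mulmx; [move/subspace_continuousP: cG|move/subspace_continuousP: cHP]; exact.
- by apply/subspace_continuousP => y cy; exact: cvg_cst.
move=> y [Oy OPy]; apply/row_matrixP => i; rewrite !rowE mulmx1 mulmxA -dG // -dH //.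
have : 'd (Psi \o Phi) y = 'd Psi (Phi y) \o 'd Phi y :> (E -> E).
  by apply: diff_comp; [exact: difPhi|exact: difPsi].
(* Near [y] the composite [Psi \o Phi] is the identity, hence so is its differential at [y]. *)
move=> /(congr1 (fun f => f (delta_mx ord0 i))) /= <-.
have idd : differentiable (id : E -> E) y by exact: ex_diff.
have [||_ ->] := diff_near_eq _ _ idd (g := Psi \o Phi).
- by rewrite /= PsiK //; exact: subset_closure.
- near=> z; rewrite /= PsiK //; apply: subset_closure.
  by near: z; exact: open_nbhs_nbhs.
by rewrite diff_val.
Unshelve. all: by end_near. Qed.

Lemma compact_closed_ball (x : E) (r : R) : compact [set y : E | `|x - y| <= r].
Proof.
apply: bounded_closed_compact.
  exists (`|x| + r); split; first exact: num_real.
  move=> M xM y /= yr; apply: le_trans (ltW xM).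
  by rewrite -[y](subKr x); apply: (le_trans (ler_normB _ _)); rewrite lerD2l.
apply: (@closed_comp _ _ (fun y : E => `|x - y|) [set s | s <= r]); last exact: closed_le.
move=> y _; apply: cvg_norm; apply: cvgB; [exact: cvg_cst|exact: cvg_id].
Qed.

(** By [local_surj] the image of [Omega] is a neighbourhood of [Phi x]. It lies in the closure, so
    [Phi x] is interior to the closure. *)
Lemma Diff_interior Omega Phi : open Omega -> (closure Omega)° `<=` Omega ->
  Diff Omega Phi -> forall x, Omega x -> Omega (Phi x).
Proof.
move=> oO reg dPhi x Ox; apply: reg.
have [CPhi [Phi_fun Phi_inj _] _] := dPhi.
have [G [cG dG]] := Ck1_jacobian CPhi.
have [_ [difPhi _]] := CPhi.
have : nbhs (Phi x) (Phi @` Omega).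
  apply: (local_surj _ oO Ox difPhi).
  - exact: compact_closed_ball.
  - move=> z Oz w; exists (w *m invmx (G z)); rewrite dG // -mulmxA mulVmx ?mulmx1 //.
    by apply: (Diff_unitmx oO dPhi cG dG); exact: subset_closure.
  - by move=> z1 z2 O1 O2; apply: Phi_inj; rewrite inE; exact: subset_closure.
apply: filterS => _ [z Oz <-]; apply: Phi_fun; exact: subset_closure.
Qed.

Lemma Diff_boundary Omega Phi : open Omega -> (closure Omega)° `<=` Omega ->
  Diff Omega Phi -> forall x, closure Omega x -> Omega (Phi x) -> Omega x.
Proof.
move=> oO reg dPhi x cx OPx; have [Psi [dPsi PsiK _]] := Diff_sym dPhi.
by rewrite -(PsiK _ cx); exact: Diff_interior dPsi _ OPx.
Qed.

End Diffeomorphisms.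

(** * The vector field of an isotopy *)

Lemma mx_entry_le_norm (R : realType) m k (M : 'M[R]_(m, k)) i j : `|M i j| <= `|M|.
Proof.
rewrite [leRHS]/Num.Def.normr /= mx_normrE.
exact: (le_bigmax _ (fun ij : 'I_m * 'I_k => `|M ij.1 ij.2|) (i, j)).
Qed.

(** Restriction to a line and to one coordinate gives the scalar form on which the mean value
    theorem operates. *)
Lemma is_derive_line (R : realType) (V : normedModType R) k (Z : V -> 'rV[R]_k)
    (p v : V) j (s : R) : differentiable Z (s *: v + p) ->
  is_derive s 1 (fun u : R => Z (u *: v + p) ord0 j) ('d Z (s *: v + p) v ord0 j).
Proof.
move=> dZ; pose l (u : R) : V := u *: v + p.
have [dl El] : differentiable l s /\ 'd l s = (fun u : R => u *: v) :> (R -> V).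
  apply: diff_of_eps.
  - by move=> a x y; rewrite scalerDl scalerA.
  - by move=> u; apply: cvgZ; [exact: cvg_id|exact: cvg_cst].
  move=> e e0; apply/nbhs_ballP; exists 1 => //= h _.
  rewrite /l scalerDl opprD addrACA subrr addr0 addrK subrr normr0.
  by rewrite mulr_ge0 // ltW.
have dZl : differentiable (Z \o l) s by exact: differentiable_comp.
have der : derivable (Z \o l) s 1 by exact: diff_derivable.
split; first by move/derivable_mxP: der.
have := derive_mx der; rewrite deriveE // diff_comp //= El scale1r => ->.
by rewrite mxE.
Qed.

(** The part of [K] outside the interior of [N] is compact, so its image is closed; that image
    misses [A q], and its complement is the required neighbourhood. *)
Lemma inverse_within_continuous (T U : topologicalType) (K : set T) (A : T -> U) (B : U -> T) :
  hausdorff_space U -> compact K -> {within K, continuous A} ->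
  (forall q, K q -> B (A q) = q) -> {within A @` K, continuous B}.
Proof.
move=> hU cK cA BA; apply/within_nearP => _ [q Kq <-] N; rewrite BA // => Nq.
have cKN : compact (A @` (K `&` ~` N°)).
  apply: continuous_compact.
    by apply: continuous_subspaceW cA => x [].
  by apply: compact_closedI => //; apply: open_closedC; exact: open_interior.
have oKN : open (~` (A @` (K `&` ~` N°))).
  by apply: closed_openC; exact: compact_closed.
have nbh : nbhs (A q) (~` (A @` (K `&` ~` N°))).
  apply: open_nbhs_nbhs; split => // -[q' [Kq' nq'] /(congr1 B)].
  by rewrite !BA // => qq'; apply: nq'; rewrite qq'; exact: Nq.
apply: filterS nbh => y ny [q' Kq' yq']; rewrite -yq' BA //.
apply: contrapT => nN; apply: ny; exists q' => //; split => //.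
by move=> /interior_subset.
Qed.

Lemma continuous_pairl (S T : topologicalType) (t : T) : continuous (fun x : S => (x, t)).
Proof. by move=> x; exact: (cvg_pair cvg_id (cvg_cst t)). Qed.

Lemma continuous_pairr (S T : topologicalType) (x : S) : continuous (fun t : T => (x, t)).
Proof. by move=> t; exact: (cvg_pair (cvg_cst x) cvg_id). Qed.

(** * Time slices of maps on the cylinder *)

Section Slices.
Context {R : realType} {n : nat}.
Local Notation E := 'rV[R]_n.+1.
Implicit Types (Omega : set E).

Lemma within_slice (W : topologicalType) Omega (f : E * R -> W) t :
  0 <= t <= 1 -> {within closure (cylinder Omega), continuous f} ->
  {within closure Omega, continuous (fun xi => f (xi, t))}.
Proof.
move=> t01; apply: within_comp.
  by move=> xi cxi; rewrite closure_cylinder; split => //=; rewrite in_itv.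
by apply: continuous_subspaceT; exact: continuous_pairl.
Qed.

Lemma within_section (W : topologicalType) Omega (f : E * R -> W) xi :
  closure Omega xi -> {within closure (cylinder Omega), continuous f} ->
  {within [set` `[0, 1]], continuous (fun t : R => f (xi, t))}.
Proof.
move=> cxi; apply: within_comp.
  by move=> t t01; rewrite closure_cylinder; split.
by apply: continuous_subspaceT; exact: continuous_pairr.
Qed.

(* For t = 0 and t = 1 the extension G of the spatial Jacobian is a priori only
   a limit of Jacobians at other times; the mean value theorem turns it into
   the Jacobian of the limit map. *)
Lemma jacobian_slice Omega (X : E * R -> E) (G : E * R -> 'M[R]_n.+1) t :
  open Omega -> 0 <= t <= 1 -> Ck 1 (cylinder Omega) X ->
  {within closure (cylinder Omega), continuous G} ->
  (forall p, cylinder Omega p -> forall a, 'd X p (a, 0) = a *m G p) ->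
  Ck 1 Omega (fun xi => X (xi, t)) ->
  forall xi, Omega xi -> forall a, 'd (fun xi => X (xi, t)) xi a = a *m G (xi, t).
Proof.
move=> oO t01 [cX [dX _]] cG dG [_ [df _]] xi Oxi a.
apply/rowP => j; apply/eqP; rewrite -subr_eq0 -normr_le0.
pose L := (a *m G (xi, t)) ord0 j.
pose D := 'd (fun xi => X (xi, t)) xi a ord0 j.
rewrite -/L -/D.
have cxit : closure (cylinder Omega) (xi, t).
  by rewrite closure_cylinder; split; [exact: subset_closure|rewrite /= in_itv].
have key eta : 0 < eta -> `|D - L| <= eta * (`|a| + 1).
  move=> eta0.
  have cGL : \forall p \near (xi, t), closure (cylinder Omega) p ->
      `|(a *m G p) ord0 j - L| < eta.
    have : (fun p => (a *m G p) ord0 j) @ within (closure (cylinder Omega)) (nbhs (xi, t)) --> L.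
      apply: cvg_mx_coord; apply: cvg_mulmx; first exact: cvg_cst.
      by move/subspace_continuousP : cG; exact.
    move=> /cvgrPdist_lt /(_ _ eta0) h.
    have {}h : \forall p \near (xi, t), closure (cylinder Omega) p ->
      `|L - (a *m G p) ord0 j| < eta by exact: h.
    by apply: filterS h => p h /h; rewrite distrC.
  have [[N1 N2] /= [N1xi N2t] N12] := cGL.
  have cl : (fun e : R => e *: a) @ 0^'+ --> (0 : E).
    rewrite -[X in _ --> X](scale0r a).
    apply: cvgZ; last exact: cvg_cst.
    by apply: cvg_at_right_filter; exact: cvg_id.
  have cl2 : (fun e : R => e *: a + xi) @ (0 : R) --> xi.
    rewrite -[X in _ --> X]add0r -[X in X + _](scale0r a).
    apply: cvgD; last exact: cvg_cst.
    by apply: cvgZ; [exact: cvg_id|exact: cvg_cst].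
  have nO : nbhs xi Omega by exact: open_nbhs_nbhs.
  have : \forall u \near (0 : R), (N1 `&` Omega) (u *: a + xi).
    exact: (cl2 _ (filterI N1xi nO)).
  move=> /nbhs_ballP[d /= d0 hd].
  have small : \forall e \near 0^'+, `|X (e *: a + xi, t) - X (xi, t)
      - 'd (fun xi => X (xi, t)) xi (e *: a)| <= eta * `|e *: a|.
    exact: (cl _ (diff_eps (df _ Oxi) eta0)).
  near (0 : R)^'+ => e.
  have e0 : 0 < e by near: e; exact: nbhs_right_gt.
  have ed : e < d by near: e; exact: nbhs_right_lt.
  have hN u : 0 <= u <= e -> N1 (u *: a + xi) /\ Omega (u *: a + xi).
    move=> /andP[u0 ue]; apply: hd; rewrite /ball /= sub0r normrN ger0_norm //.
    exact: le_lt_trans ed.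
  have Oe : Omega (e *: a + xi) by apply: (hN e _).2; rewrite lexx ltW.
  have he : `|X (e *: a + xi, t) - X (xi, t)
      - 'd (fun xi => X (xi, t)) xi (e *: a)| <= eta * `|e *: a|.
    by near: e; exact: small.
  (* At interior times the mean value theorem along the segment from [xi] to [e *: a + xi] writes
     the increment as [e * dg u] with [dg u] within [eta] of [L]. *)
  have hm s : [set` `]0, 1[] s -> N2 s ->
      `|X (e *: a + xi, s) ord0 j - X (xi, s) ord0 j - e * L| <= eta * e.
    move=> s01 N2s.
    pose g (u : R) := X (u *: (a, 0) + (xi, s)) ord0 j.
    have lineE u : u *: (a, 0) + (xi, s) = (u *: a + xi, s).
      transitivity ((u *: a + xi, u * 0 + s) : E * R) => //.
      by rewrite mulr0 add0r.
    pose dg u := (a *m G (u *: a + xi, s)) ord0 j.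
    have der u : 0 <= u <= e -> is_derive u 1 g (dg u).
      move=> /hN[_ Ou].
      have cu : cylinder Omega (u *: (a, 0) + (xi, s)) by rewrite lineE; split.
      have := @is_derive_line _ _ _ _ _ _ j _ (dX _ cu).
      by rewrite dG // lineE.
    have [u uI gu] : exists2 u, u \in `]0, e[ & g e - g 0 = dg u * (e - 0).
      apply: MVT => // [u|].
        by rewrite in_itv /= => /andP[u0 ue]; apply: der; rewrite !ltW.
      apply: derivable_within_continuous => u.
      rewrite in_itv /= => /der du; exact: ex_derive.
    move: uI; rewrite in_itv /= => /andP[u0 ue].
    have [N1u Ou] : N1 (u *: a + xi) /\ Omega (u *: a + xi) by apply: hN; rewrite !ltW.
    have : `|dg u - L| < eta.
      apply: (N12 (u *: a + xi, s)); first by split.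
      by apply: subset_closure; split.
    move: gu; rewrite /g !lineE scale0r add0r subr0 => -> /ltW h.
    by rewrite mulrC -mulrBr normrM gtr0_norm // mulrC ler_wpM2r // ltW.
  (* Continuity of [X] up to the ends of the time interval carries the estimate from interior times
     [s] to [t]. *)
  have hmt : `|X (e *: a + xi, t) ord0 j - X (xi, t) ord0 j - e * L| <= eta * e.
    pose F := within [set` `]0, (1 : R)[] (nbhs t).
    have FF : ProperFilter F.
      apply: Build_ProperFilter_ex => P; rewrite /F /within /= => /nbhs_ballP[b /= b0 bP].
      have [s [s01 _ ts]] := itv01_approx t01 b0.
      by exists s; apply: bP => //=; rewrite in_itv.
    have cXF y : Omega y -> (fun s => X (y, s) ord0 j) @ F --> X (y, t) ord0 j.
      move=> Oy; apply: cvg_mx_coord => N XN.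
      have /within_nearP/(_ t _ N XN) h := within_section (subset_closure Oy) cX.
      have {}h : \forall s \near t, [set` `[0, (1 : R)]] s -> N (X (y, s)).
        by apply: h; rewrite /= in_itv.
      suff : \forall s \near t, [set` `]0, (1 : R)[] s -> N (X (y, s)) by [].
      apply: filterS h => s h; rewrite /= in_itv /= => /andP[s0 s1].
      by apply: h; rewrite /= in_itv /= !ltW.
    have c1 : (fun s => `|X (e *: a + xi, s) ord0 j - X (xi, s) ord0 j - e * L|) @ F -->
        `|X (e *: a + xi, t) ord0 j - X (xi, t) ord0 j - e * L|.
      apply: cvg_norm; apply: cvgB; last exact: cvg_cst.
      by apply: cvgB; exact: cXF.
    apply: (ler_cvg_to c1 (cvg_cst _)).
    suff : \forall s \near t, [set` `]0, (1 : R)[] s ->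
          `|X (e *: a + xi, s) ord0 j - X (xi, s) ord0 j - e * L| <= eta * e by [].
    by apply: filterS N2t => s N2s s01; exact: hm.
  (* Both [e * L] and [e * D] approximate the same increment at time [t]; they are compared and [e]
     is cancelled. *)
  have := le_trans (mx_entry_le_norm _ ord0 j) he.
  rewrite linearZ /= !mxE -/D normrZ gtr0_norm // => he'.
  rewrite -(ler_pM2l e0) -{1}(gtr0_norm e0) -normrM mulrBr.
  set x1 := X _ _ _ in hmt he'; set x0 := X (xi, t) _ _ in hmt he'.
  have -> : e * D - e * L = (x1 - x0 - e * L) - (x1 - x0 - e * D) by ring.
  apply: (le_trans (ler_normB _ _)); apply: (le_trans (lerD hmt he')).
  by rewrite mulrCA mulrDr mulr1 mulrDr addrC [e * eta]mulrC mulrCA.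
rewrite leNgt; apply/negP => l0.
have a1 : 0 < 2 * (`|a| + 1) by rewrite mulr_gt0 // ltr_wpDl.
have := key _ (divr_gt0 l0 a1).
by rewrite mulrAC ler_pdivlMr // leNgt => /negP; apply; have := normr_ge0 a; nra.
Unshelve. all: by end_near. Qed.

End Slices.

(** * Regularity of the field carried by the isotopy *)

Section Transport.
Context {R : realType} {n : nat}.
Local Notation E := 'rV[R]_n.+1.
Implicit Types (Omega : set E).

Lemma bounded_closure_compact Omega : bounded_set Omega -> compact (closure Omega).
Proof.
move=> [M [_ /(_ (M + 1))]]; rewrite ltrDl => /(_ ltr01) OM.
apply: (@subclosed_compact _ _ [set y : E | `|0 - y| <= M + 1]);
  [exact: closed_closure|exact: compact_closed_ball|].
have cM : closed [set y : E | `|0 - y| <= M + 1].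
  apply: compact_closed; [exact: norm_hausdorff|exact: compact_closed_ball].
rewrite ((closure_id _).1 cM); apply: closureS => y Oy.
by rewrite /= sub0r normrN; exact: OM.
Qed.

(** Keeping time as a second component turns the family of maps [X (-, t)] into one map, to be
    inverted for all [t] at once. *)
Lemma differentiable_suspension (X : E * R -> E) q : differentiable X q ->
  differentiable (fun q => (X q, q.2)) q /\
  'd (fun q => (X q, q.2)) q = (fun h => ('d X q h, h.2)) :> (E * R -> E * R).
Proof.
move=> dX.
have [d2 E2] : differentiable (fun q : E * R => q.2) q /\
    'd (fun q : E * R => q.2) q = snd :> (E * R -> R).
  apply: diff_of_eps; [by []|by move=> p; exact: cvg_snd|].
  move=> e e0; apply/nbhs_ballP; exists 1 => //= h _.
  by rewrite addrK subrr normr0 mulr_ge0 // ltW.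
by split; [exact: differentiable_pair|rewrite diff_pair // E2].
Qed.

Section Field.
Context (Omega : set E) (X dX : E * R -> E).
Context (oO : open Omega) (reg : (closure Omega)° `<=` Omega)
  (cO : compact (closure Omega)) (CX : Ck 1 (cylinder Omega) X)
  (CdX : Ck 1 (cylinder Omega) dX)
  (dfX : forall t, 0 <= t <= 1 -> Diff Omega (fun xi => X (xi, t))).

Let K := closure (cylinder Omega).

Lemma closed_cylinderP xi t : K (xi, t) <-> closure Omega xi /\ 0 <= t <= 1.
Proof. by rewrite /K closure_cylinder /= in_itv. Qed.

(** The inverse of the slice at time [p.2], by choice; the default 0 is taken when there is no
    preimage, which does not happen on [K]. *)
Definition back (p : E * R) : E :=
  xget 0 [set xi | closure Omega xi /\ X (xi, p.2) = p.1].

Lemma backP x t : closure Omega x -> 0 <= t <= 1 ->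
  closure Omega (back (x, t)) /\ X (back (x, t), t) = x.
Proof.
move=> cx t01; have [_ [_ _ X_surj] _] := dfX t01.
have [xi cxi Xxi] := X_surj _ cx.
exact: (@xgetPex _ 0 [set xi | closure Omega xi /\ X (xi, t) = x] (ex_intro _ xi (conj cxi Xxi))).
Qed.

Lemma forward_closure xi t : closure Omega xi -> 0 <= t <= 1 -> closure Omega (X (xi, t)).
Proof. by move=> cxi t01; have [_ [X_fun _ _] _] := dfX t01; exact: X_fun. Qed.

Lemma backK xi t : closure Omega xi -> 0 <= t <= 1 -> back (X (xi, t), t) = xi.
Proof.
move=> cxi t01; have [cb Xb] := backP (forward_closure cxi t01) t01.
by have [_ [_ X_inj _] _] := dfX t01; apply: X_inj; rewrite ?inE.
Qed.

Lemma forward_interior xi t : closure Omega xi -> 0 <= t <= 1 ->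
  Omega (X (xi, t)) <-> Omega xi.
Proof.
move=> cxi t01; split; first exact: (Diff_boundary oO reg (dfX t01)).
exact: (Diff_interior oO reg (dfX t01)).
Qed.

Let A (q : E * R) : E * R := (X q, q.2).
Let B (p : E * R) : E * R := (back p, p.2).

Lemma back_closed p : K p -> K (B p).
Proof.
case: p => x t /closed_cylinderP[cx t01]; apply/closed_cylinderP.
by split; [exact: (backP cx t01).1|].
Qed.

Lemma back_cylinder p : cylinder Omega p -> cylinder Omega (B p) /\ A (B p) = p.
Proof.
case: p => x t [/= Ox tI].
have t01 : 0 <= t <= 1 by move: tI; rewrite in_itv /= => /andP[t0 t1]; rewrite !ltW.
have [cb Xb] := backP (subset_closure Ox) t01.
by rewrite /A /B /= Xb; split => //; split => //=; apply/(forward_interior cb t01); rewrite Xb.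
Qed.

(** [A] is a continuous injection of the compact set [K] onto itself and [B] is its inverse;
    continuity is thus joint in space and time. *)
Lemma back_continuous : {within K, continuous B}.
Proof.
have cA : {within K, continuous A}.
  have [cX _] := CX; apply/within_nearP => q Kq N [[N1 N2] /= [N1q N2q] N12].
  have h1 : \forall q' \near q, K q' -> N1 (X q') by move/within_nearP: cX; exact.
  have h2 : \forall q' \near q, N2 q'.2 by exact: cvg_snd.
  by apply: filterS2 h1 h2 => q' h1 h2 Kq'; apply: N12; split => //; exact: h1.
have AK : A @` K = K.
  apply/seteqP; split => [_ [[xi t] /closed_cylinderP[cxi t01] <-]|[x t] /closed_cylinderP[cx t01]].
    by apply/closed_cylinderP; split => //; exact: forward_closure.
  have [cb Xb] := backP cx t01.
  by exists (back (x, t), t); [apply/closed_cylinderP|rewrite /A Xb].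
suff : {within A @` K, continuous B} by rewrite AK.
apply: inverse_within_continuous.
- exact: norm_hausdorff.
- rewrite /K closure_cylinder; apply: compact_setX => //; exact: segment_compact.
- exact: cA.
- by case=> xi t /closed_cylinderP[cxi t01]; rewrite /A /B /= backK.
Qed.

Lemma field_Ck1 : Ck 1 (cylinder Omega) (fun p => dX (back p, p.2)).
Proof.
have [G [g [cG cg dXE]]] := Ck1_jacobian_prod CX.
have [G' [g' [cG' cg' ddXE]]] := Ck1_jacobian_prod CdX.
have [_ [difX _]] := CX; have [cdX [difdX _]] := CdX.
(* [jacobian_slice] identifies [G (-, t)] with the Jacobian of the slice for every [t] in [[0, 1]],
   so that [Diff_unitmx] applies to it. *)
have uG q : K q -> G q \in unitmx.
  case: q => xi t /closed_cylinderP[cxi t01].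
  apply: (Diff_unitmx oO (dfX t01) (G := fun xi => G (xi, t))) => //.
    exact: within_slice.
  apply: jacobian_slice => //; last by have [] := dfX t01.
  by move=> p Op a; rewrite dXE // scale0r addr0.
have oC : open (cylinder Omega).
  rewrite openE => -[x t] [/= Ox tI]; exists (Omega, [set` `]0, (1 : R)[]) => //=.
  split; apply: open_nbhs_nbhs; split => //; exact: interval_open.
have difB p : cylinder Omega p -> differentiable B p /\
    'd B p = (fun h => ((h.1 - h.2 *: g (B p)) *m invmx (G (B p)), h.2)) :> (E * R -> E * R).
  move=> Op; have [OB ABp] := back_cylinder Op.
  set q := B p in OB ABp *.
  have [dA EA] : differentiable A q /\ 'd A q = (fun h => ('d X q h, h.2)) :> (E * R -> E * R).
    by apply: differentiable_suspension; exact: difX.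
  (* The differential of [A] at [q] is the block triangular map
     [(a, s) |-> (a *m G q + s *: g q, s)], and [L] is its inverse. *)
  pose L (h : E * R) : E * R := ((h.1 - h.2 *: g q) *m invmx (G q), h.2).
  have lL : linear L.
    move=> a [x1 s1] [x2 s2].
    transitivity ((((a *: x1 + x2) - (a * s1 + s2) *: g q) *m invmx (G q),
      a * s1 + s2) : E * R) => //.
    transitivity ((a *: ((x1 - s1 *: g q) *m invmx (G q)) + (x2 - s2 *: g q) *m invmx (G q),
      a * s1 + s2) : E * R) => //.
    congr pair; rewrite scalemxAl -mulmxDl; congr (_ *m _).
    by rewrite scalerBr scalerDl scalerA opprD addrACA.
  have cL : continuous L.
    have c1 (h : E * R) : (fun h : E * R => (h.1 - h.2 *: g q) *m invmx (G q)) @ h -->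
        (h.1 - h.2 *: g q) *m invmx (G q).
      apply: cvg_mulmx; last exact: cvg_cst.
      apply: cvgB; first exact: cvg_fst.
      by apply: cvgZ; [exact: cvg_snd|exact: cvg_cst].
    by move=> h; exact: (cvg_pair (c1 h) cvg_snd).
  have LA h : L ('d A q h) = h.
    case: h => a s; rewrite EA /L /= dXE // addrK mulmxK //; apply: uG.
    exact: subset_closure.
  have cB : {for A q, continuous B}.
    by rewrite ABp; exact: (continuous_open_within oC (@subset_closure _ _) Op back_continuous).
  have BA : B (A q) = q by rewrite ABp.
  have AB : \forall y \near A q, A (B y) = y.
    rewrite ABp; apply: filterS (open_nbhs_nbhs (conj oC Op)).
    by move=> y /back_cylinder[].
  by have := inverse_diff dA lL cL LA cB BA AB; rewrite ABp.
have difv p : cylinder Omega p -> differentiable (dX \o B) p.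
  move=> Op; apply: differentiable_comp; first exact: (difB _ Op).1.
  by apply: difdX; exact: (back_cylinder Op).1.
split; first exact: (within_comp back_closed back_continuous cdX).
split => [|[a s]]; first exact: difv.
(* This is the chain rule for [dX \o B] in the direction [(a, s)]. The formula is continuous on all
   of [K], hence gives the extension. *)
exists (fun p => (a - s *: g (B p)) *m invmx (G (B p)) *m G' (B p) + s *: g' (B p)); split.
  split => //; apply/subspace_continuousP => p Kp.
  have cc (m k : nat) (f : E * R -> 'M[R]_(m, k)) : {within K, continuous f} ->
      (fun p => f (B p)) @ within K (nbhs p) --> f (B p).
    by move=> /(within_comp back_closed back_continuous) /subspace_continuousP; exact.
  apply: cvgD; last by apply: cvgZ; [exact: cvg_cst|exact: cc].
  apply: cvg_mulmx; last exact: cc.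
  apply: cvg_mulmx.
    by apply: cvgB; [exact: cvg_cst|apply: cvgZ; [exact: cvg_cst|exact: cc]].
  by apply: cvg_invmx; [apply: uG; exact: back_closed|exact: cc].
move=> p Op; have [OB _] := back_cylinder Op; have [dB EB] := difB _ Op.
rewrite deriveE; last exact: difv.
rewrite -/(dX \o B) diff_comp //=; last exact: difdX.
by rewrite EB /= ddXE.
Qed.

End Field.
End Transport.

(** * The isotopy as the flow of a tangential field *)

Theorem proposition3p3 (R : realType) (n : nat) (Omega : set 'rV[R]_n.+1)
    (Phi : 'rV[R]_n.+1 -> 'rV[R]_n.+1)
    (hOmega : bounded_lipschitz_domain Omega)
    (hPhi : Diff0 Omega Phi) :
  exists v : 'rV[R]_n.+1 * R -> 'rV[R]_n.+1,
    V0 Omega v /\ is_time_one_map Omega v Phi.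
Proof.
have reg := lipschitz_domain_regular hOmega.
have [oO _ _ bO _] := hOmega.
have cO := bounded_closure_compact bO.
have [_ [X [dX [[CX CdX dXE] X0 X1 dfX _]]]] := hPhi.
exists (fun p => dX (back Omega X p, p.2)); split; last first.
  exists X; split=> [xi cxi|xi cxi]; last by rewrite X1.
  split; first by move=> t t01; exact: (forward_closure dfX).
  - by have [cX _] := CX; exact: (within_section cxi cX).
  - exact: X0.
  - move=> t /andP[t0 t1]; have t01 : 0 <= t <= 1 by rewrite ltW.
    by rewrite /= (backK dfX) //; exact: dXE.
split; first exact: field_Ck1.
move=> t t01; rewrite /ae_boundary (_ : [set _ | _] = set0) ?hausdorff_set0 //.
apply/seteqP; split => // x [[cx nOx] []] nu.
have [cb Xb] := backP dfX cx t01.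
(* [x] is viewed as the position at time [t] of the trajectory that starts at
   [back Omega X (x, t)]. *)
rewrite /= -{1}Xb => nux.
(* If this trajectory were in [Omega] at time [s], its starting point would be too, and then also
   its position [x] at time [t]. *)
have bb s : 0 <= s <= 1 -> boundary Omega (X (back Omega X (x, t), s)).
  move=> s01; split; first exact: (forward_closure dfX).
  rewrite ((interior_id _).1 oO) => Os; apply: nOx; rewrite ((interior_id _).1 oO).
  have Oxi := (forward_interior oO reg dfX cb s01).1 Os.
  by rewrite -Xb; exact: ((forward_interior oO reg dfX cb t01).2 Oxi).
exact: (tangent_boundary oO t01 nux bb (dXE _ _ cb t01)).
Qed.
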